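(* The disjunction property holds for the logic LRC: for all LRC-formulas $B$ and $C$, if $B\vee C$ is an LRC-theorem, then $B$ is an LRC-theorem or $C$ is an LRC-theorem.
   Context: LANGUAGE. Fix countable disjoint sets $\mathsf{AtProp}$ (atomic propositions) and $\mathsf{AtRes}$ (atomic resources). Resource terms: $\alpha::=a\in\mathsf{AtRes}\mid 1\mid 0\mid\alpha\cdot\alpha\mid\alpha\sqcup\alpha\mid\alpha\sqcap\alpha$. LRC-formulas: $A::=p\in\mathsf{AtProp}\mid\top\mid\bot\mid A\vee A\mid A\wedge A\mid A\to A\mid\alpha\vartriangleright A\mid\Diamond A\mid\Diamond_r\alpha\mid\alpha\vartriangleright_r\alpha$. Here $\vartriangleright$ takes a resource and a formula, $\Diamond$ a formula, $\Diamond_r$ a resource, $\vartriangleright_r$ two resources; all four produce formulas. $\Diamond,\Diamond_r,\vartriangleright,\vartriangleright_r$ bind more strongly than $\wedge,\vee$, which bind more strongly than $\to$. HILBERT SYSTEM H.LRC. Resource entailment $\alpha\vdash\beta$ is the least preorder on resource terms such that: (R1) $\sqcup$ and $\sqcap$ are join and meet and distribute over each other; (R2) $\cdot$ is associative with unit $1$ (up to mutual entailment); (R3) $\alpha\vdash1$ and $0\vdash\alpha$; (R4) $\alpha\cdot(\beta\sqcup\gamma)\vdash(\alpha\cdot\beta)\sqcup(\alpha\cdot\gamma)$ and $(\beta\sqcup\gamma)\cdot\alpha\vdash(\beta\cdot\alpha)\sqcup(\gamma\cdot\alpha)$; (MF, MF') if $\alpha\vdash\beta$ then $\alpha\cdot\gamma\vdash\beta\cdot\gamma$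 and $\gamma\cdot\alpha\vdash\gamma\cdot\beta$. The set of LRC-theorems is the least set of formulas containing the axioms of intuitionistic propositional logic and all instances of: (D1) $\Diamond(A\vee B)\leftrightarrow\Diamond A\vee\Diamond B$; (D2) $\Diamond\bot\leftrightarrow\bot$; (D3) $\Diamond_r(\alpha\sqcup\beta)\leftrightarrow\Diamond_r\alpha\vee\Diamond_r\beta$; (D4) $\Diamond_r0\leftrightarrow\bot$; (B1) $(\alpha\sqcup\beta)\vartriangleright A\leftrightarrow\alpha\vartriangleright A\wedge\beta\vartriangleright A$; (B2) $0\vartriangleright A$; (B3) $\alpha\vartriangleright(\beta\vartriangleright A)\to(\alpha\cdot\beta)\vartriangleright A$; (B4) $(\alpha\sqcup\beta)\vartriangleright_r\gamma\leftrightarrow\alpha\vartriangleright_r\gamma\wedge\beta\vartriangleright_r\gamma$; (B5) $0\vartriangleright_r\alpha$; (B6) $\alpha\vartriangleright_r(\beta\sqcap\gamma)\leftrightarrow\alpha\vartriangleright_r\beta\wedge\alpha\vartriangleright_r\gamma$; (B7) $\alpha\vartriangleright_r1$; (BD1) $\Diamond_r\alpha\wedge\alpha\vartriangleright A\to\Diamond A$; (BD2) $\alpha\vartriangleright_r\beta\to\alpha\vartriangleright\Diamond_r\beta$; closed under modus ponens, uniform substitution and the rules: if $A\to B$ is a theorem, so are $\alpha\vartriangleright A\to\alpha\vartriangleright B$ (MB) and $\Diamond A\to\Diamond B$ (MD); if $\alpha\vdash\beta$, then $\beta\vartriangleright A\to\alpha\vartriangleright A$ (AB), $\Diamond_r\alpha\to\Diamond_r\beta$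 (MD'), $\gamma\vartriangleright_r\alpha\to\gamma\vartriangleright_r\beta$ (MB'), $\beta\vartriangleright_r\gamma\to\alpha\vartriangleright_r\gamma$ (AB') are theorems. *)

(* Defs.v *)
From mathcomp Require Import all_boot.

Set Implicit Arguments.
Unset Strict Implicit.
Unset Printing Implicit Defensive.

Declare Scope lrc_scope.
Delimit Scope lrc_scope with LRC.

(* Atomic resources and atomic propositions live in different types, so the
   two sets of atoms are disjoint by construction. *)
Inductive resource (AtRes : Type) : Type :=
  | RAtom of AtRes
  | ROne
  | RZero
  | RMul of resource AtRes & resource AtRes
  | RJoin of resource AtRes & resource AtRes
  | RMeet of resource AtRes & resource AtRes.

Arguments ROne {AtRes}.
Arguments RZero {AtRes}.

Inductive formula (AtProp AtRes : Type) : Type :=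
  | FAtom of AtProp
  | FTop
  | FBot
  | FOr of formula AtProp AtRes & formula AtProp AtRes
  | FAnd of formula AtProp AtRes & formula AtProp AtRes
  | FImp of formula AtProp AtRes & formula AtProp AtRes
  | FBox of resource AtRes & formula AtProp AtRes
  | FDia of formula AtProp AtRes
  | FDiaR of resource AtRes
  | FBoxR of resource AtRes & resource AtRes.

Arguments FAtom {AtProp AtRes} _.
Arguments FTop {AtProp AtRes}.
Arguments FBot {AtProp AtRes}.
Arguments FDiaR {AtProp AtRes} _.
Arguments FBoxR {AtProp AtRes} _ _.

Notation "a ⋅ b" := (RMul a b) (at level 40, left associativity) : lrc_scope.
Notation "a ⊓ b" := (RMeet a b) (at level 45, left associativity) : lrc_scope.
Notation "a ⊔ b" := (RJoin a b) (at level 50, left associativity) : lrc_scope.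

Notation "a ▷ A" := (FBox a A) (at level 60, right associativity) : lrc_scope.
Notation "a ▷ᵣ b" := (FBoxR a b) (at level 60, no associativity) : lrc_scope.
Notation "◇ A" := (FDia A) (at level 60, right associativity) : lrc_scope.
Notation "◇ᵣ a" := (FDiaR a) (at level 60, right associativity) : lrc_scope.
Notation "A ∧ B" := (FAnd A B) (at level 80, right associativity) : lrc_scope.
Notation "A ∨ B" := (FOr A B) (at level 85, right associativity) : lrc_scope.
Notation "A ⇒ B" := (FImp A B) (at level 90, right associativity) : lrc_scope.
Notation "A ⇔ B" := (FAnd (FImp A B) (FImp B A))
  (at level 95, no associativity) : lrc_scope.

Local Open Scope lrc_scope.

Reserved Notation "a ⊢ b" (at level 70, no associativity).

Inductive rentails (AtRes : Type) : resource AtRes -> resource AtRes -> Prop :=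
  | r_refl a : a ⊢ a
  | r_trans a b c : a ⊢ b -> b ⊢ c -> a ⊢ c
  | r_join_l a b : a ⊢ a ⊔ b
  | r_join_r a b : b ⊢ a ⊔ b
  | r_join_lub a b c : a ⊢ c -> b ⊢ c -> a ⊔ b ⊢ c
  | r_meet_l a b : a ⊓ b ⊢ a
  | r_meet_r a b : a ⊓ b ⊢ b
  | r_meet_glb a b c : c ⊢ a -> c ⊢ b -> c ⊢ a ⊓ b
  (* the converses of the two distributive laws hold in every lattice *)
  | r_meet_join a b c : a ⊓ (b ⊔ c) ⊢ (a ⊓ b) ⊔ (a ⊓ c)
  | r_join_meet a b c : (a ⊔ b) ⊓ (a ⊔ c) ⊢ a ⊔ (b ⊓ c)
  | r_mulA a b c : a ⋅ (b ⋅ c) ⊢ (a ⋅ b) ⋅ c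
  | r_mulA_conv a b c : (a ⋅ b) ⋅ c ⊢ a ⋅ (b ⋅ c)
  | r_mul1 a : a ⋅ ROne ⊢ a
  | r_mul1_conv a : a ⊢ a ⋅ ROne
  | r_1mul a : ROne ⋅ a ⊢ a
  | r_1mul_conv a : a ⊢ ROne ⋅ a
  | r_one a : a ⊢ ROne
  | r_zero a : RZero ⊢ a
  | r_mul_join a b c : a ⋅ (b ⊔ c) ⊢ (a ⋅ b) ⊔ (a ⋅ c)
  | r_join_mul a b c : (b ⊔ c) ⋅ a ⊢ (b ⋅ a) ⊔ (c ⋅ a)
  | r_mulS a b c : a ⊢ b -> a ⋅ c ⊢ b ⋅ c
  | r_Smul a b c : a ⊢ b -> c ⋅ a ⊢ c ⋅ b
where "a ⊢ b" := (rentails a b) : lrc_scope.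

Fixpoint rsubst (AtRes : Type) (tau : AtRes -> resource AtRes)
    (a : resource AtRes) : resource AtRes :=
  match a with
  | RAtom x => tau x
  | ROne => ROne
  | RZero => RZero
  | b ⋅ c => rsubst tau b ⋅ rsubst tau c
  | b ⊔ c => rsubst tau b ⊔ rsubst tau c
  | b ⊓ c => rsubst tau b ⊓ rsubst tau c
  end.

Fixpoint fsubst (AtProp AtRes : Type)
    (sigma : AtProp -> formula AtProp AtRes) (tau : AtRes -> resource AtRes)
    (A : formula AtProp AtRes) : formula AtProp AtRes :=
  match A with
  | FAtom p => sigma p
  | FTop => FTop
  | FBot => FBot
  | B ∨ C => fsubst sigma tau B ∨ fsubst sigma tau C
  | B ∧ C => fsubst sigma tau B ∧ fsubst sigma tau C
  | B ⇒ C => fsubst sigma tau B ⇒ fsubst sigma tau C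
  | a ▷ B => rsubst tau a ▷ fsubst sigma tau B
  | ◇ B => ◇ fsubst sigma tau B
  | ◇ᵣ a => ◇ᵣ rsubst tau a
  | a ▷ᵣ b => rsubst tau a ▷ᵣ rsubst tau b
  end.

Inductive int_axiom (AtProp AtRes : Type) : formula AtProp AtRes -> Prop :=
  | int_K A B : int_axiom (A ⇒ B ⇒ A)
  | int_S A B C : int_axiom ((A ⇒ B ⇒ C) ⇒ (A ⇒ B) ⇒ A ⇒ C)
  | int_and_l A B : int_axiom (A ∧ B ⇒ A)
  | int_and_r A B : int_axiom (A ∧ B ⇒ B)
  | int_and_intro A B : int_axiom (A ⇒ B ⇒ A ∧ B)
  | int_or_l A B : int_axiom (A ⇒ A ∨ B)
  | int_or_r A B : int_axiom (B ⇒ A ∨ B)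
  | int_or_elim A B C : int_axiom ((A ⇒ C) ⇒ (B ⇒ C) ⇒ A ∨ B ⇒ C)
  | int_bot A : int_axiom (FBot ⇒ A)
  | int_top : int_axiom FTop.

Inductive lrc_axiom (AtProp AtRes : Type) : formula AtProp AtRes -> Prop :=
  | lrc_D1 A B : lrc_axiom (◇ (A ∨ B) ⇔ ◇ A ∨ ◇ B)
  | lrc_D2 : lrc_axiom (◇ FBot ⇔ FBot)
  | lrc_D3 a b : lrc_axiom (◇ᵣ (a ⊔ b) ⇔ ◇ᵣ a ∨ ◇ᵣ b)
  | lrc_D4 : lrc_axiom (◇ᵣ RZero ⇔ FBot)
  | lrc_B1 a b A : lrc_axiom ((a ⊔ b) ▷ A ⇔ a ▷ A ∧ b ▷ A)
  | lrc_B2 A : lrc_axiom (RZero ▷ A)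
  | lrc_B3 a b A : lrc_axiom (a ▷ (b ▷ A) ⇒ (a ⋅ b) ▷ A)
  | lrc_B4 a b c : lrc_axiom ((a ⊔ b) ▷ᵣ c ⇔ a ▷ᵣ c ∧ b ▷ᵣ c)
  | lrc_B5 a : lrc_axiom (RZero ▷ᵣ a)
  | lrc_B6 a b c : lrc_axiom (a ▷ᵣ (b ⊓ c) ⇔ a ▷ᵣ b ∧ a ▷ᵣ c)
  | lrc_B7 a : lrc_axiom (a ▷ᵣ ROne)
  | lrc_BD1 a A : lrc_axiom (◇ᵣ a ∧ a ▷ A ⇒ ◇ A)
  | lrc_BD2 a b : lrc_axiom (a ▷ᵣ b ⇒ a ▷ (◇ᵣ b)).

Inductive lrc_theorem (AtProp AtRes : Type) : formula AtProp AtRes -> Prop :=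
  | thm_int A : int_axiom A -> lrc_theorem A
  | thm_lrc A : lrc_axiom A -> lrc_theorem A
  | thm_mp A B : lrc_theorem (A ⇒ B) -> lrc_theorem A -> lrc_theorem B
  | thm_subst sigma tau A : lrc_theorem A -> lrc_theorem (fsubst sigma tau A)
  | thm_MB a A B : lrc_theorem (A ⇒ B) -> lrc_theorem (a ▷ A ⇒ a ▷ B)
  | thm_MD A B : lrc_theorem (A ⇒ B) -> lrc_theorem (◇ A ⇒ ◇ B)
  | thm_AB a b A : a ⊢ b -> lrc_theorem (b ▷ A ⇒ a ▷ A)
  | thm_MD' a b : a ⊢ b -> lrc_theorem (◇ᵣ a ⇒ ◇ᵣ b)
  | thm_MB' a b c : a ⊢ b -> lrc_theorem (c ▷ᵣ a ⇒ c ▷ᵣ b)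
  | thm_AB' a b c : a ⊢ b -> lrc_theorem (b ▷ᵣ c ⇒ a ▷ᵣ c).

(* Main.v *)
(** Aczel's slash: a predicate [slash], stronger than theoremhood and splitting
    disjunctions, which every theorem satisfies.  The modal axioms and rules
    conclude a diamond formula only from another one or from ⊥, except BD2,
    where the diamond lies under a box.  So ◇A and ◇ᵣα can be declared never
    slashed, while α▷A and α▷ᵣβ are slashed as soon as they are theorems. *)

Require Import Defs.
From mathcomp Require Import all_boot.

Set Implicit Arguments.
Unset Strict Implicit.
Unset Printing Implicit Defensive.

Local Open Scope lrc_scope.

Section Slash.

Variables AtProp AtRes : Type.
Implicit Types A B C : formula AtProp AtRes.

(** In the clause for [⇒], theoremhood must be demanded explicitly: passing from slashed [B] to
    slashed [C] does not by itself make [B ⇒ C] provable. *)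
Fixpoint slash A : Prop :=
  match A with
  | FTop => True
  | FBot | ◇ _ | ◇ᵣ _ => False
  | B ∨ C => slash B \/ slash C
  | B ∧ C => slash B /\ slash C
  | B ⇒ C => lrc_theorem (B ⇒ C) /\ (slash B -> slash C)
  | FAtom _ | _ ▷ _ | _ ▷ᵣ _ => lrc_theorem A
  end.

Lemma thm_and A B :
  lrc_theorem (A ∧ B) <-> lrc_theorem A /\ lrc_theorem B.
Proof.
split=> [tAB | [tA tB]].
  by split; apply: thm_mp tAB; apply: thm_int; constructor.
by apply: thm_mp tB; apply: thm_mp tA; apply: thm_int; constructor.
Qed.

Lemma slash_theorem A : slash A -> lrc_theorem A.
Proof.
elim: A => //=.
- by move=> _; apply/thm_int/int_top.
- move=> A IHA B IHB [/IHA | /IHB]; apply: thm_mp; apply: thm_int;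
    by [apply: int_or_l | apply: int_or_r].
- by move=> A IHA B IHB [/IHA tA /IHB tB]; apply/thm_and.
- by move=> A _ B _ [].
Qed.

Lemma thm_mp_slash A B : lrc_theorem (A ⇒ B) -> slash A -> lrc_theorem B.
Proof. by move=> tAB /slash_theorem; apply: thm_mp. Qed.

Lemma slash_iff A B :
  lrc_theorem (A ⇔ B) -> (slash A <-> slash B) -> slash (A ⇔ B).
Proof. by move=> /thm_and[tAB tBA] [sAB sBA]. Qed.

(** Each nested implication must itself be a theorem once its premises are slashed; slashed premises
    are theorems, so modus ponens on the axiom provides this. *)
Lemma slash_int_axiom A : int_axiom A -> slash A.
Proof.
move=> axA; have := thm_int axA; case: axA => {A}.
- by move=> A B t; split=> // sA; split=> //; apply: thm_mp_slash t sA.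
- move=> A B C t; split=> // sABC.
  have t' := thm_mp_slash t sABC; split=> // sAB.
  split; first exact: thm_mp_slash t' sAB.
  by case: sABC sAB => _ sABC [_ sAB] sA; apply: (sABC sA).2 (sAB sA).
- by move=> A B t; split=> // -[].
- by move=> A B t; split=> // -[].
- by move=> A B t; split=> // sA; split=> //; apply: thm_mp_slash t sA.
- by move=> A B t; split=> //; left.
- by move=> A B t; split=> //; right.
- move=> A B C t; split=> // sAC.
  have t' := thm_mp_slash t sAC; split=> // sBC.
  split; first exact: thm_mp_slash t' sBC.
  by case: sAC sBC => _ sAC [_ sBC] [].
- by move=> A t; split.
- by [].
Qed.

Lemma slash_lrc_axiom A : lrc_axiom A -> slash A.
Proof.
(* For box formulas slash is theoremhood, so this settles B1, B4 and B6. *)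
have boxes B C D : lrc_theorem (B ⇔ C ∧ D) ->
    lrc_theorem B <-> lrc_theorem C /\ lrc_theorem D.
  move=> /thm_and[t1 t2]; split=> [tB|/thm_and]; last exact: thm_mp.
  exact/thm_and/(thm_mp t1).
move=> axA; have := thm_lrc axA; case: axA => {A}.
- by move=> A B /slash_iff; apply=> /=; tauto.
- by move=> /slash_iff; apply.
- by move=> a b /slash_iff; apply=> /=; tauto.
- by move=> /slash_iff; apply.
- by move=> a b A t; apply: (slash_iff t); apply: boxes.
- by [].
- by move=> a b A t; split=> // /(thm_mp t).
- by move=> a b c t; apply: (slash_iff t); apply: boxes.
- by [].
- by move=> a b c t; apply: (slash_iff t); apply: boxes.
- by [].
(* BD1 holds vacuously: its premise contains [◇ᵣ a], which is never slashed. *)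
- by move=> a A t; split=> // -[].
- by move=> a b t; split=> // /(thm_mp t).
Qed.

Lemma rsubst_comp (tau tau' : AtRes -> resource AtRes) a :
  rsubst tau' (rsubst tau a) = rsubst (fun x => rsubst tau' (tau x)) a.
Proof. by elim: a => //= a -> b ->. Qed.

Lemma rsubst_id (a : resource AtRes) : rsubst (@RAtom AtRes) a = a.
Proof. by elim: a => //= a -> b ->. Qed.

(** Two successive substitutions merge into one, to which the induction hypothesis applies in the
    case of the substitution rule. *)
Lemma fsubst_comp (sigma sigma' : AtProp -> formula AtProp AtRes)
    (tau tau' : AtRes -> resource AtRes) A :
  fsubst sigma' tau' (fsubst sigma tau A) =
  fsubst (fun p => fsubst sigma' tau' (sigma p))
         (fun x => rsubst tau' (tau x)) A.
Proof.
by elim: A => //= [A -> B ->|A -> B ->|A -> B ->|a A ->|A ->|a|a b];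
  rewrite ?rsubst_comp.
Qed.

Lemma fsubst_id A : fsubst FAtom (@RAtom AtRes) A = A.
Proof.
by elim: A => //= [A -> B ->|A -> B ->|A -> B ->|a A ->|A ->|a|a b];
  rewrite ?rsubst_id.
Qed.

Lemma int_axiom_subst sigma (tau : AtRes -> resource AtRes) A :
  int_axiom A -> int_axiom (fsubst sigma tau A).
Proof. by case=> * /=; constructor. Qed.

Lemma lrc_axiom_subst sigma (tau : AtRes -> resource AtRes) A :
  lrc_axiom A -> lrc_axiom (fsubst sigma tau A).
Proof. by case=> * /=; constructor. Qed.

(* Closure of [slash] under substitution is only known a posteriori, so the
   substitution is carried through the induction. *)
Lemma slash_subst_theorem A :
  lrc_theorem A -> forall sigma tau, slash (fsubst sigma tau A).
Proof.
have rule B C sigma tau : lrc_theorem (B ⇒ C) ->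
    lrc_theorem (fsubst sigma tau B ⇒ fsubst sigma tau C).
  exact: (@thm_subst _ _ sigma tau (B ⇒ C)).
elim=> {A}.
- by move=> A axA sigma tau; apply/slash_int_axiom/int_axiom_subst.
- by move=> A axA sigma tau; apply/slash_lrc_axiom/lrc_axiom_subst.
- by move=> A B _ sAB _ sA sigma tau; apply: (sAB _ _).2 (sA _ _).
- by move=> sigma tau A _ sA sigma' tau'; rewrite fsubst_comp.
(* The conclusion is an implication between boxes, so its slash clause reduces to modus ponens. *)
- move=> a A B tAB _ sigma tau /=.
  by have t := rule _ _ sigma tau (thm_MB a tAB); split=> //; apply: thm_mp.
(* Diamonds are never slashed, so only theoremhood is left to prove. *)
- by move=> A B tAB _ sigma tau; split=> //; apply/rule/thm_MD.
- move=> a b A ab sigma tau /=.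
  by have t := rule _ _ sigma tau (thm_AB A ab); split=> //; apply: thm_mp.
- by move=> a b ab sigma tau; split=> //; apply/rule/thm_MD'.
- move=> a b c ab sigma tau /=.
  by have t := rule _ _ sigma tau (thm_MB' AtProp c ab); split=> //;
    apply: thm_mp.
- move=> a b c ab sigma tau /=.
  by have t := rule _ _ sigma tau (thm_AB' AtProp c ab); split=> //;
    apply: thm_mp.
Qed.

Lemma theorem_slash A : lrc_theorem A -> slash A.
Proof. by move/slash_subst_theorem/(_ FAtom (@RAtom _)); rewrite fsubst_id. Qed.

End Slash.

Theorem proposition2p9 (AtProp AtRes : countType) (B C : formula AtProp AtRes) :
  lrc_theorem (FOr B C) -> lrc_theorem B \/ lrc_theorem C.
Proof.
by move/theorem_slash=> /= [] /slash_theorem; [left | right].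
Qed.
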